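(* Let $(A,+_A,\cdot_A,\alpha)$ be a unitary regular Hom-ring with compatible ring $(A,+_A',\cdot_A')$. (1) If $(M,+_M,\beta)$ is a regular left $A$-module, then $$\beta(a\rhd m)=\alpha(a)\rhd\beta(m)\quad\text{for all }a\in A,\ m\in M,$$ where $a\rhd m=\beta^{-1}(am)$ defines an $(A,+_A',\cdot_A')$-module structure on $(M,\beta^{-1}\circ +_M)$. (2) Suppose that $(M,+_M')$ is a left module over the ring $(A,+_A',\cdot_A')$ for the action $a\rhd m$. If there exists an automorphism $\beta$ of the group $(M,+_M')$ such that $\beta(a\rhd m)=\alpha(a)\rhd\beta(m)$ for all $a\in A$, $m\in M$, then $(M,+_M=\beta\circ +_M',\beta)$ is a left module over the Hom-ring $(A,+_A,\cdot_A,\alpha)$ with respect to the action $am=\beta(a\rhd m)$, for all $a\in A$ and $m\in M$.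
   Context: An abelian Hom-group $(M,+,0,\beta)$ is a set $M$ with an element $0$, a commutative operation $+$ and a map $\beta:M\to M$ such that for all $x,y,z$: $\beta(x)+(y+z)=(x+y)+\beta(z)$; $\beta(x+y)=\beta(x)+\beta(y)$; $x+0=0+x=\beta(x)$, $\beta(0)=0$; there is a map $x\mapsto-x$ with $-(x+y)=(-y)+(-x)$; for each $x$ there is a natural number $k$ with $\beta^k(x+(-x))=0$. In this statement ''Hom-ring'' means $\alpha$-Hom-ring of type $(1)$: $(A,+,\cdot,0,\alpha)$ such that $(A,+,0,\alpha)$ is an abelian Hom-group, $\alpha(xy)=\alpha(x)\alpha(y)$, $\alpha(x)(yz)=(xy)\alpha(z)$, $\alpha(x)(y+z)=xy+xz$ and $(y+z)\alpha(x)=yx+zx$ for all $x,y,z\in A$. It is unitary if there is $1_A\in A$ with $x1_A=1_Ax=\alpha(x)$ for all $x$ and $\alpha(1_A)=1_A$; regular if $\alpha$ is bijective. The compatible ring of a regular Hom-ring is the ring $(A,+',\cdot',0)$ with $x+'y=\alpha^{-1}(x+y)$, $x\cdot'y=\alpha^{-1}(x\cdot y)$. A left $A$-module over a unitary Hom-ring $A$ is an abelian Hom-group $(M,+_M,\beta)$ with an action $A\times M\to M$, $(a,m)\mapsto am$, such that $\alpha(a)(m_1+_Mm_2)=am_1+_Mam_2$, $(a+_Ab)\beta(m)=am+_Mbm$, $(a\cdot b)\beta(m)=\alpha(a)(bm)$, $1_Am=\beta(m)$ for all $a,b\in A$, $m,m_1,m_2\in M$. It is regular if $\beta$ is invertible.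 The notation $\beta^{\pm1}\circ+$ denotes the operation $(x,y)\mapsto\beta^{\pm1}(x+y)$. *)

(* Defs.v *)
From HB Require Import structures.
From mathcomp Require Import all_boot all_algebra.
From mathcomp Require Import boolp.

Set Implicit Arguments.
Unset Strict Implicit.
Unset Printing Implicit Defensive.

Import GRing.Theory.
Local Open Scope ring_scope.

Record abelian_hom_group (M : Type) (add : M -> M -> M) (zero : M)
    (beta : M -> M) : Prop := AbelianHomGroup {
  hom_addC : forall x y, add x y = add y x;
  hom_addA : forall x y z, add (beta x) (add y z) = add (add x y) (beta z);
  hom_twistD : forall x y, beta (add x y) = add (beta x) (beta y);
  hom_addr0 : forall x, add x zero = beta x;
  hom_add0r : forall x, add zero x = beta x;
  hom_twist0 : beta zero = zero;
  hom_oppP : exists opp : M -> M,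
    (forall x y, opp (add x y) = add (opp y) (opp x)) /\
    (forall x, exists k, iter k beta (add x (opp x)) = zero)
}.

(* alpha-Hom-rings of type (1) *)
Record hom_ring (A : Type) (add mul : A -> A -> A) (zero : A)
    (alpha : A -> A) : Prop := HomRing {
  hom_ring_group : abelian_hom_group add zero alpha;
  hom_twistM : forall x y, alpha (mul x y) = mul (alpha x) (alpha y);
  hom_mulA : forall x y z, mul (alpha x) (mul y z) = mul (mul x y) (alpha z);
  hom_mulDr : forall x y z, mul (alpha x) (add y z) = add (mul x y) (mul x z);
  hom_mulDl : forall x y z, mul (add y z) (alpha x) = add (mul y x) (mul z x)
}.

Record hom_unit (A : Type) (mul : A -> A -> A) (alpha : A -> A) (one : A) :
    Prop := HomUnit {
  hom_mulr1 : forall x, mul x one = alpha x;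
  hom_mul1r : forall x, mul one x = alpha x;
  hom_twist1 : alpha one = one
}.

Record unitHomRing := UnitHomRing {
  hr_sort :> Type;
  hadd : hr_sort -> hr_sort -> hr_sort;
  hmul : hr_sort -> hr_sort -> hr_sort;
  hzero : hr_sort;
  hone : hr_sort;
  halpha : hr_sort -> hr_sort;
  hr_ringP : hom_ring hadd hmul hzero halpha;
  hr_unitP : hom_unit hmul halpha hone
}.

(* Regularity (bijectivity of the twisting map) is recorded through the
   two-sided inverse of the twisting map. *)
Record regUnitHomRing := RegUnitHomRing {
  rhr_base :> unitHomRing;
  halphaV : rhr_base -> rhr_base;
  halphaK : cancel (@halpha rhr_base) halphaV;
  halphaVK : cancel halphaV (@halpha rhr_base)
}.

Record hom_module (A : unitHomRing) (M : Type) (add : M -> M -> M) (zero : M)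
    (beta : M -> M) (act : A -> M -> M) : Prop := HomModule {
  hom_mod_group : abelian_hom_group add zero beta;
  hom_actDr : forall a m1 m2,
    act (halpha a) (add m1 m2) = add (act a m1) (act a m2);
  hom_actDl : forall a b m, act (hadd a b) (beta m) = add (act a m) (act b m);
  hom_actA : forall a b m, act (hmul a b) (beta m) = act (halpha a) (act b m);
  hom_act1 : forall m, act (hone A) m = beta m
}.

(* [add] and [scale] are the addition and the scaling of some left R-module
   structure on the carrier M; the zero and the opposite are determined by
   [add]. *)
Definition lmodule_structure (R : pzRingType) (M : Type) (add : M -> M -> M)
    (scale : R -> M -> M) : Prop :=
  exists c : GRing.Lmodule R M,
    let V : lmodType R := GRing.Lmodule.Pack c in
    (forall x y : V, x + y = add x y) /\
    (forall (a : R) (x : V), a *: x = scale a x).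

Definition compat_ring (A : regUnitHomRing) : Type := A.

Section CompatRing.
Variable A : regUnitHomRing.
Let T := compat_ring A.

Definition compat_add (x y : T) : T := halphaV (@hadd A x y).
Definition compat_mul (x y : T) : T := halphaV (@hmul A x y).

Let rP := @hr_ringP A.
Let gP := hom_ring_group rP.
Let uP := @hr_unitP A.

Definition compat_opp : T -> T := sval (cid (hom_oppP gP)).

Let aI : injective (@halpha A) := can_inj (@halphaK A).

Let halphaVD (x y : A) :
  halphaV (hadd x y) = hadd (halphaV x) (halphaV y).
Proof. by apply: aI; rewrite (hom_twistD gP) !halphaVK. Qed.

Let halphaVM (x y : A) :
  halphaV (hmul x y) = hmul (halphaV x) (halphaV y).
Proof. by apply: aI; rewrite (hom_twistM rP) !halphaVK. Qed.

Lemma compat_addA : associative compat_add.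
Proof.
move=> x y z; rewrite /compat_add; congr halphaV; apply: aI.
by rewrite !(hom_twistD gP) !halphaVK (hom_addA gP).
Qed.

Lemma compat_addC : commutative compat_add.
Proof. by move=> x y; rewrite /compat_add (hom_addC gP). Qed.

Lemma compat_add0 : left_id (hzero A) compat_add.
Proof. by move=> x; rewrite /compat_add (hom_add0r gP) halphaK. Qed.

Lemma compat_addN : left_inverse (hzero A) compat_opp compat_add.
Proof.
move=> x; rewrite compat_addC /compat_add /compat_opp.
case: cid => opp /= [_ oppK]; have [k] := oppK x.
have iter0 n : iter n (@halpha A) (hzero A) = hzero A.
  by elim: n => //= n ->; rewrite (hom_twist0 gP).
rewrite -[RHS in _ = RHS -> _](iter0 k).
have iterI : injective (iter k (@halpha A)).
  by elim: k => //= k IH u v /aI /IH.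
by move=> /iterI ->; apply: aI; rewrite halphaVK (hom_twist0 gP).
Qed.

Lemma compat_mulA : associative compat_mul.
Proof.
move=> x y z; rewrite /compat_mul; congr halphaV; apply: aI.
by rewrite !(hom_twistM rP) !halphaVK (hom_mulA rP).
Qed.

Lemma compat_mul1r : left_id (hone A) compat_mul.
Proof. by move=> x; rewrite /compat_mul (hom_mul1r uP) halphaK. Qed.

Lemma compat_mulr1 : right_id (hone A) compat_mul.
Proof. by move=> x; rewrite /compat_mul (hom_mulr1 uP) halphaK. Qed.

Lemma compat_mulDl : left_distributive compat_mul compat_add.
Proof.
move=> x y z; rewrite /compat_mul /compat_add; congr halphaV; apply: aI.
by rewrite (hom_twistM rP) (hom_twistD gP) !halphaVK (hom_mulDl rP).
Qed.

Lemma compat_mulDr : right_distributive compat_mul compat_add.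
Proof.
move=> x y z; rewrite /compat_mul /compat_add; congr halphaV; apply: aI.
by rewrite (hom_twistM rP) (hom_twistD gP) !halphaVK (hom_mulDr rP).
Qed.

HB.instance Definition _ := gen_eqMixin T.
HB.instance Definition _ := gen_choiceMixin T.
HB.instance Definition _ := GRing.isZmodule.Build T
  compat_addA compat_addC compat_add0 compat_addN.
HB.instance Definition _ := GRing.Zmodule_isPzRing.Build T
  compat_mulA compat_mul1r compat_mulr1 compat_mulDl compat_mulDr.

End CompatRing.

Lemma compat_addE (A : regUnitHomRing) (x y : compat_ring A) :
  x + y = halphaV (@hadd A x y).
Proof. by []. Qed.

Lemma compat_mulE (A : regUnitHomRing) (x y : compat_ring A) :
  x * y = halphaV (@hmul A x y).
Proof. by []. Qed.

(* Main.v *)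
Require Import Defs.
From HB Require Import structures.
From mathcomp Require Import all_boot all_algebra.
From mathcomp Require Import boolp.
Set Implicit Arguments.
Unset Strict Implicit.
Unset Printing Implicit Defensive.
Import GRing.Theory.
Local Open Scope ring_scope.

(** Twisting and untwisting by an automorphism are mutually inverse. When the
    twisting map [beta] is bijective, every Hom-axiom is an ordinary axiom for
    the operations composed with the inverse of [beta], up to powers of [beta]
    that can be cancelled; conversely, composing the operations of a group or
    module with [beta] produces the Hom-axioms. Both directions use that
    [beta] is additive and compatible with the action along [alpha].
    Additivity is an axiom of abelian Hom-groups. Compatibility with the
    action is not an axiom of modules, and the key point of the first half is
    that it follows from the unit: since the unit acts as [beta] and is fixed
    by [alpha],
    [beta (a m) = alpha(1) (a m) = (1 a) beta(m) = alpha(a) beta(m)]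
    (lemma [hom_twist_act]). The group axioms ([untwist_addA], [untwist_addN])
    and the module axioms ([untwist_module]) then follow by applying the
    injective map [beta] and pushing it through the operations. In the second
    half ([twist_module]) this compatibility is the hypothesis, and the sum
    and product of the Hom-ring are the images under [alpha] of those of the
    compatible ring, so that the Hom-module axioms are the images under powers
    of [beta] of the module axioms. *)

Section Untwisting.
Variables (M : Type) (add : M -> M -> M) (zero : M) (beta betaV : M -> M).
Hypotheses (betaK : cancel beta betaV) (betaVK : cancel betaV beta).
Hypothesis gP : abelian_hom_group add zero beta.

Let betaI : injective beta := can_inj betaK.

Lemma untwist_addA : associative (fun x y => betaV (add x y)).
Proof.
move=> x y z; congr betaV; apply: betaI.
by rewrite !(hom_twistD gP) !betaVK (hom_addA gP).
Qed.

Lemma untwist_add0 : left_id zero (fun x y => betaV (add x y)).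
Proof. by move=> x; rewrite (hom_add0r gP) betaK. Qed.

(** The opposite of a Hom-group is an inverse only up to a power of [beta]
    depending on the element; as [beta] is injective and fixes [zero], that
    power can be removed. *)
Lemma untwist_addN :
  exists opp, left_inverse zero opp (fun x y => betaV (add x y)).
Proof.
have [opp [_ oppK]] := hom_oppP gP; exists opp => x.
have [k] := oppK x; rewrite (hom_addC gP (opp x)).
elim: k => [|k IHk] /= opp0; last first.
  by apply/IHk/betaI; rewrite opp0 (hom_twist0 gP).
by apply: betaI; rewrite betaVK opp0 (hom_twist0 gP).
Qed.

End Untwisting.

(** Packages unbundled module axioms on a bare type, whose equality and choice
    structures come from classical logic. *)
Lemma lmodule_structure_of_axioms (R : pzRingType) (M : Type)
    (add : M -> M -> M) (zero : M) (opp : M -> M) (scale : R -> M -> M) :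
    associative add -> commutative add -> left_id zero add ->
    left_inverse zero opp add ->
    (forall a b m, scale a (scale b m) = scale (a * b) m) ->
    (forall m, scale 1 m = m) ->
    (forall a, {morph scale a : m1 m2 / add m1 m2}) ->
    (forall m a b, scale (a + b) m = add (scale a m) (scale b m)) ->
  lmodule_structure add scale.
Proof.
move=> addA addC add0 addN scaleA scale1 scaleDr scaleDl.
pose C : choiceType := HB.pack M (gen_eqMixin M) (gen_choiceMixin M).
pose Z : zmodType :=
  HB.pack (M : Type) C (@GRing.isZmodule.Build C zero opp add addA addC add0 addN).
pose V : lmodType R := HB.pack (M : Type) Z
  (@GRing.Zmodule_isLmodule.Build R Z scale scaleA scale1 scaleDr scaleDl).
by exists (GRing.Lmodule.class V).
Qed.

(** The multiplicativity of the twisting map of a module is a consequence of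
    the unit axioms: apply the associativity of the action to [1], [a], [m]. *)
Lemma hom_twist_act (A : unitHomRing) (M : Type) (add : M -> M -> M)
    (zero : M) (beta : M -> M) (act : A -> M -> M) (a : A) (m : M) :
  hom_module add zero beta act ->
  beta (act a m) = act (halpha a) (beta m).
Proof.
move=> mP; have uP := hr_unitP A.
by rewrite -(hom_act1 mP) -[in LHS](hom_twist1 uP) -(hom_actA mP) (hom_mul1r uP).
Qed.

Lemma untwist_module (A : regUnitHomRing) (M : Type) (add : M -> M -> M)
    (zero : M) (beta betaV : M -> M) (act : A -> M -> M) :
    cancel beta betaV -> cancel betaV beta ->
    hom_module add zero beta act ->
  @lmodule_structure (compat_ring A) M (fun x y => betaV (add x y))
    (fun a m => betaV (act a m)).
Proof.
move=> betaK betaVK mP; have gP := hom_mod_group mP.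
have betaI := can_inj betaK.
have [opp addN] := untwist_addN betaK betaVK gP.
apply: (lmodule_structure_of_axioms (zero := zero) (opp := opp)) => //.
- exact: untwist_addA betaK betaVK gP.
- by move=> x y; rewrite (hom_addC gP).
- exact: untwist_add0 betaK gP.
- move=> a b m; congr betaV; apply: betaI.
  by rewrite !(hom_twist_act _ _ mP) betaVK compat_mulE halphaVK (hom_actA mP).
- by move=> m; rewrite (hom_act1 mP) betaK.
- move=> a m1 m2; congr betaV; apply: betaI.
  by rewrite (hom_twist_act _ _ mP) (hom_twistD gP) !betaVK (hom_actDr mP).
- move=> m a b; congr betaV; apply: betaI.
  rewrite (hom_twist_act _ _ mP) (hom_twistD gP) !betaVK compat_addE halphaVK.
  exact: hom_actDl mP _ _ _.
Qed.

Lemma twist_group (M : zmodType) (beta : {additive M -> M}) :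
  abelian_hom_group (fun x y => beta (x + y)) 0 beta.
Proof.
split=> [x y|x y z|x y|x|x||].
- by rewrite addrC.
- by rewrite -!raddfD addrA.
- by rewrite -raddfD.
- by rewrite addr0.
- by rewrite add0r.
- exact: raddf0.
- exists -%R; split=> [x y|x]; first by rewrite -raddfN opprD addrC.
  by exists 0%N; rewrite /= subrr raddf0.
Qed.

Lemma twist_module (A : regUnitHomRing) (M : lmodType (compat_ring A))
    (beta : {additive M -> M}) :
    (forall (a : compat_ring A) (m : M),
      beta (a *: m) = (@halpha A a : compat_ring A) *: beta m) ->
  @hom_module A M (fun x y => beta (x + y)) 0 beta
    (fun (a : compat_ring A) (m : M) => beta (a *: m)).
Proof.
move=> betaZ.
(* These present the Hom-ring as the twist of its compatible ring by [halpha],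
   so that [betaZ] turns [halpha] acting on [beta m] into an outer [beta]. *)
have haddE (a b : compat_ring A) : @hadd A a b = @halpha A (a + b).
  by rewrite compat_addE halphaVK.
have hmulE (a b : compat_ring A) : @hmul A a b = @halpha A (a * b).
  by rewrite compat_mulE halphaVK.
split=> [|a m1 m2|a b m|a b m|m].
- exact: twist_group.
- by rewrite -betaZ scalerDr raddfD.
- by rewrite haddE -betaZ scalerDl raddfD.
- by rewrite hmulE -!betaZ scalerA.
- by rewrite [X in beta X]scale1r.
Qed.

Theorem theorem7p9 (A : regUnitHomRing) :
  (forall (M : Type) (addM : M -> M -> M) (zeroM : M) (beta betaV : M -> M)
      (act : A -> M -> M),
    cancel beta betaV -> cancel betaV beta ->
    hom_module addM zeroM beta act ->
    let rhd (a : A) (m : M) : M := betaV (act a m) in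
    (forall (a : A) (m : M), beta (rhd a m) = rhd (halpha a) (beta m)) /\
    @lmodule_structure (compat_ring A) M (fun x y => betaV (addM x y)) rhd)
  /\
  (forall (M : lmodType (compat_ring A)) (beta : {additive M -> M}),
    bijective beta ->
    (forall (a : compat_ring A) (m : M),
      beta (a *: m) = (@halpha A a : compat_ring A) *: beta m) ->
    @hom_module A M (fun x y => beta (x + y)) 0 beta
      (fun (a : compat_ring A) (m : M) => beta (a *: m))).
Proof.
split=> [M addM zeroM beta betaV act betaK betaVK mP rhd|M beta _ betaZ].
  split=> [a m|]; last exact: untwist_module betaK betaVK mP.
  by rewrite /rhd betaVK -(hom_twist_act _ _ mP) betaK.
exact: twist_module.
Qed.
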